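(* Let $F$ be a distribution on $[0,\infty)$ with unbounded support and let $\gamma\ge0$. Then $F\in\mathcal S(\gamma)$ if and only if the following three conditions hold: (a) $\gamma=\hat\gamma$; (b) for some $c\in[2,\infty)$, $\overline{F*F}(x)\sim c\,\overline{F}(x)$ as $x\to\infty$; (c) for every fixed real $y$, $$\liminf_{x\to\infty}\frac{\overline{F}(x-y)}{\overline{F}(x)}\ge e^{\gamma y}.$$
   Context: $\overline{F}(x)=F(x,\infty)$, positive for all $x$ (unbounded support). $\varphi(\gamma)=\int_0^\infty e^{\gamma x}F(dx)\in(0,\infty]$; $\hat\gamma=\sup\{\gamma:\varphi(\gamma)<\infty\}$. For $\gamma\ge0$, $F$ belongs to $\mathcal S(\gamma)$ if (i) $\varphi(\gamma)<\infty$; (ii) for every fixed $y$, $\overline{F}(x+y)/\overline{F}(x)\to e^{-\gamma y}$ as $x\to\infty$; (iii) $\overline{F*F}(x)\sim 2\varphi(\gamma)\overline{F}(x)$ as $x\to\infty$. *)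

(* Defs.v *)
From HB Require Import structures.
From mathcomp Require Import all_boot all_order all_algebra.
From mathcomp Require Import all_classical all_reals all_analysis.
Set Implicit Arguments. Unset Strict Implicit. Unset Printing Implicit Defensive.
Import Order.TTheory GRing.Theory Num.Theory.
Import numFieldNormedType.Exports.
Local Open Scope classical_set_scope.
Local Open Scope ring_scope.

Definition supported_on_nonneg (R : realType) (F : probability R R) : Prop :=
  F [set x : R | (x < 0)%R] = 0%E.

Definition unbounded_support (R : realType) (F : probability R R) : Prop :=
  forall x : R, (0 < F [set y : R | (x < y)%R])%E.

Definition tail (R : realType) (F : probability R R) (x : R) : R :=
  fine (F [set y : R | (x < y)%R]).

Definition conv_tail (R : realType) (F : probability R R) (x : R) : R :=
  fine ((F \x F) [set ab : R * R | x < ab.1 + ab.2]).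

Definition mgf (R : realType) (F : probability R R) (g : R) : \bar R :=
  (\int[F]_x (expR (g * x))%:E)%E.

Definition gamma_hat (R : realType) (F : probability R R) : \bar R :=
  ereal_sup [set (g%:E) | g in [set g : R | (mgf F g < +oo)%E]].

Definition class_S (R : realType) (g : R) (F : probability R R) : Prop :=
  [/\ (mgf F g < +oo)%E,
      (forall y : R, tail F (x + y) / tail F x @[x --> +oo] --> expR (- g * y)) &
      conv_tail F x / tail F x @[x --> +oo] --> 2 * fine (mgf F g)].

(* Main.v *)
(** Taking (c) at both [y] and [- y] gives the exact limit of the tail ratios.
    Since the events [a <= x/2, a + b > x] and [b <= x/2, a + b > x] are
    disjoint, Fatou's lemma gives [2 phi(g) <= c].  For the converse bound put
    [u(x) = e^(g x) (clamp(e^(e x), 1, T) - 1)].  It is nondecreasing, and the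
    submultiplicativity of the clamp gives
    [E u(X + Y) <= M^2 + 2 phi(g) M] with [M = E u(X)], while
    [P(X + Y > x) >= k P(X > x)] for [x >= x0] gives
    [k M <= E u(X + Y) + k u(x0)].  As [phi(g + e)] is infinite, [T] can be
    chosen so that [M] stays comparable to a fixed small [s] for every
    [e > 0], whereas [u(x0) -> 0] as [e -> 0]; hence [k <= 2 phi(g) + s]. *)

Require Import Defs.
From HB Require Import structures.
From mathcomp Require Import all_boot all_order all_algebra.
From mathcomp Require Import all_classical all_reals all_analysis.
From mathcomp Require Import measurable_realfun lra ring.
Import Order.TTheory GRing.Theory Num.Theory.
Import numFieldNormedType.Exports.
Local Open Scope classical_set_scope.
Local Open Scope ring_scope.

(** * Truncated exponential weights *)

Definition expbump {R : realType} (g e T x : R) : R :=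
  expR (g * x) * (Num.max 1 (Num.min (expR (e * x)) T) - 1).

Section bump.
Context {R : realType} (g e : R).
Hypotheses (g0 : 0 <= g) (e0 : 0 <= e).
Implicit Types T x y : R.

Lemma bump_ge0 T x : 0 <= expbump g e T x.
Proof. by rewrite mulr_ge0 ?expR_ge0// subr_ge0 le_max lexx. Qed.

Lemma bump_homo T : {homo expbump g e T : x y / x <= y}.
Proof.
move=> x y xy; rewrite /expbump ler_pM ?expR_ge0//.
- by rewrite subr_ge0 le_max lexx.
- by rewrite ler_expR ler_wpM2l.
- by rewrite lerD2r le_max2// le_min2// ler_expR ler_wpM2l.
Qed.

Lemma bump_continuous T : continuous (expbump g e T).
Proof.
have cE k : continuous (fun x : R => expR (k * x)).
  move=> x; apply: continuous_comp; last exact: continuous_expR.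
  by apply: cvgM; [exact: cvg_cst|exact: cvg_id].
move=> x; apply: cvgM; first exact: cE.
apply: cvgB; last exact: cvg_cst.
apply: (@continuous_max R R (fun=> 1) (fun x => Num.min (expR (e * x)) T));
  first exact: cvg_cst.
apply: (@continuous_min R R (fun x => expR (e * x)) (fun=> T));
  first exact: cE.
exact: cvg_cst.
Qed.

(** If 1 + w is the clamp of e^(e x) to [1, T], then 1 + w(x + y) <= (1 + w(x)) (1 + w(y));
    expanding and multiplying by e^(g (x + y)) gives the three terms. *)
Lemma bumpD T x y : 1 <= T ->
  expbump g e T (x + y) <= expbump g e T x * expbump g e T y +
    expbump g e T x * expR (g * y) + expR (g * x) * expbump g e T y.
Proof.
move=> T1; rewrite /expbump !mulrDr !expRD.
set a := expR (e * x); set b := expR (e * y).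
have a0 : 0 < a by exact: expR_gt0.
have b0 : 0 < b by exact: expR_gt0.
set p := expR (g * x); set q := expR (g * y).
suff /(ler_wpM2l (mulr_ge0 (expR_ge0 (g * x)) (expR_ge0 (g * y)))) :
    Num.max 1 (Num.min (a * b) T) <=
    Num.max 1 (Num.min a T) * Num.max 1 (Num.min b T).
  by rewrite -/p -/q; lra.
have ge1 (z : R) : 1 <= Num.max 1 z by rewrite le_max lexx.
rewrite ge_max; apply/andP; split; first by rewrite -[leLHS]mulr1 ler_pM.
have [aT|Ta] := leP a T; last first.
  rewrite ge_min; apply/orP; right; rewrite -[leLHS]mulr1.
  by rewrite ler_pM// ?le_max ?lexx ?orbT//; lra.
have [bT|Tb] := leP b T; last first.
  rewrite ge_min; apply/orP; right; rewrite -[leLHS]mul1r.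
  by rewrite ler_pM// ?le_max ?lexx ?orbT//; lra.
by rewrite ge_min; apply/orP; left; rewrite ler_pM// ?le_max ?lexx ?orbT// ltW.
Qed.

(** The bound is free of [T], so [e] can be fixed first to make the weight small at a given point,
    and [T] chosen afterwards in terms of [e]. *)
Lemma bump_le T x : 0 <= x ->
  expbump g e T x <= expR (g * x) * (expR (e * x) - 1).
Proof.
move=> x0; rewrite /expbump ler_pM2l ?expR_gt0// lerD2r ge_max.
by rewrite -expR0 ler_expR mulr_ge0//= ge_min lexx.
Qed.

(** The clamp is 1-Lipschitz in its upper level. After integration, raising [T] by [h] costs at most
    h phi(g). *)
Lemma bump_lipschitz T h x : 0 <= h ->
  expbump g e (T + h) x <= expbump g e T x + h * expR (g * x).
Proof.
move=> h0; rewrite /expbump [h * _]mulrC -mulrDr ler_pM2l ?expR_gt0//.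
rewrite addrAC lerD2r /Num.max /Num.min.
by repeat case: ifPn; rewrite -?leNgt; lra.
Qed.

Lemma bump1 x : expbump g e 1 x = 0.
Proof.
rewrite /expbump; have -> : Num.max 1 (Num.min (expR (e * x)) 1) = 1 :> R.
  by apply/max_idPl; rewrite ge_min lexx orbT.
by rewrite subrr mulr0.
Qed.

Lemma bump_homoT x : {homo (fun T => expbump g e T x) : T S / T <= S}.
Proof.
move=> T S TS; rewrite /expbump ler_pM2l ?expR_gt0// lerD2r le_max2//.
by rewrite le_min2.
Qed.

Lemma expRD_le_bump T x : expR (e * x) <= T ->
  expR ((g + e) * x) <= expbump g e T x + expR (g * x).
Proof.
move=> eT; rewrite /expbump mulrDl expRD (min_idPl eT) -[X in _ + X]mulr1.
by rewrite -mulrDr subrK ler_pM2l ?expR_gt0// le_max lexx orbT.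
Qed.

Lemma measurable_bump T : measurable_fun setT (expbump g e T).
Proof. by apply: continuous_measurable_fun; exact: bump_continuous. Qed.

End bump.

(** * Comparison of expectations through tails *)

Section tail_domination.
Local Open Scope ereal_scope.
Context {d d' : measure_display} {T : measurableType d} {T' : measurableType d'}
  {R : realType} (P : probability T R) (Q : probability T' R).

(** Layer-cake formula: both expectations are integrals of tails over r >= 0. For r >= a the tails
    compare by assumption; for r < a the left integrand is at most k, which contributes k a. *)
Lemma ge0_integral_tail_le (X : T -> R) (Y : T' -> R) (k a : R) :
  measurable_fun setT X -> measurable_fun setT Y ->
  (forall x, 0 <= X x)%R -> (forall y, 0 <= Y y)%R -> (0 <= k)%R -> (0 <= a)%R ->
  (forall r, (a <= r)%R ->
    k%:E * Q [set y | (r < Y y)%R] <= P [set x | (r < X x)%R]) ->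
  k%:E * \int[Q]_y (Y y)%:E <= \int[P]_x (X x)%:E + (k * a)%:E.
Proof.
move=> mX mY X0 Y0 k0 a0 tailXY.
pose X' : {RV P >-> R} := mfun_Sub (mem_set mX).
pose Y' : {RV Q >-> R} := mfun_Sub (mem_set mY).
have ccdfE r : ccdf X' r = P [set x | (r < X x)%R].
  rewrite /ccdf /distribution /pushforward/=; congr (P _).
  by apply/seteqP; split => x /=; rewrite in_itv/= andbT.
have ccdfE' r : ccdf Y' r = Q [set x | (r < Y x)%R].
  rewrite /ccdf /distribution /pushforward/=; congr (Q _).
  by apply/seteqP; split => x /=; rewrite in_itv/= andbT.
have -> : \int[P]_x (X x)%:E = 'E_P[X'] by rewrite expectation_def.
have -> : \int[Q]_y (Y y)%:E = 'E_Q[Y'] by rewrite expectation_def.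
rewrite !ge0_expectation_ccdf//.
have mccdf d1 (U : measurableType d1) (S : probability U R) (Z : {RV S >-> R}) :
    measurable_fun (`[0%R, +oo[%classic : set R) (ccdf Z).
  by apply: measurable_funTS; exact: ccdf_measurable.
have mcX := mccdf _ _ _ X'; have mcY := mccdf _ _ _ Y'.
have mI : measurable_fun (`[0%R, +oo[%classic : set R)
    (fun r : R => (\1_`[0%R, a[ r)%:E : \bar R).
  by apply/measurable_EFinP; apply: measurable_funTS; exact: measurable_indic.
rewrite -(@ge0_integralZl _ _ _ lebesgue_measure _ _ (ccdf Y'))//.
have -> : (k * a)%:E =
    \int[lebesgue_measure]_(r in `[0%R, +oo[) (k%:E * (\1_`[0%R, a[ r)%:E).
  rewrite ge0_integralZl//.
  rewrite integral_indic// EFinM; congr (_ * _).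
  rewrite setIidl; last by apply: subset_itvl.
  rewrite /= lebesgue_measure_itv/= lte_fin.
  by case: ltgtP a0 => // [|<-] _;
    rewrite ?oppr0 ?addr0 ?sube0.
rewrite -ge0_integralD//; last 2 first.
- by move=> x _; rewrite mule_ge0// lee_fin.
- exact: measurable_funeM.
apply: ge0_le_integral => //.
- by move=> x _; rewrite mule_ge0//; exact: measure_ge0.
- exact: measurable_funeM.
- by apply: emeasurable_funD => //; exact: measurable_funeM.
- move=> r; rewrite /= in_itv/= andbT => r0; rewrite ccdfE.
  have [ar|ra] := leP a r.
    by rewrite ccdfE' (le_trans (tailXY _ ar))// leeDl// mule_ge0 ?lee_fin//.
  rewrite indicE mem_set/= ?in_itv/= ?r0// mule1 -[leLHS]add0e leeD//.
  by rewrite -[leRHS]mule1 lee_wpmul2l ?lee_fin// probability_le1.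
Qed.

End tail_domination.

(** Monotonicity makes the superlevel set an up-set, and continuity makes it open, so its infimum is
    not attained. This turns tail events of u(X) into tail events of X beyond [x0]. *)
Lemma superlevel_homo_continuous {R : realType} (u : R -> R) (x0 r : R) :
  {homo u : x y / x <= y} -> continuous u -> u x0 <= r ->
  [set x | r < u x] = set0 \/
  exists2 a, x0 <= a & [set x | r < u x] = [set x | a < x].
Proof.
move=> u_homo u_cont ux0; have [|/set0P A0] := eqVneq [set x | r < u x] set0.
  by left.
right; set A := [set x | r < u x] in A0 *.
have x0A : lbound A x0.
  move=> x; rewrite /A/= => rux; rewrite leNgt; apply/negP => /ltW/u_homo uxx0.
  by move: (lt_le_trans rux (le_trans uxx0 ux0)); rewrite ltxx.
have infA : has_inf A by split=> //; exists x0.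
exists (inf A); first exact: lb_le_inf.
apply/seteqP; split => x /=.
- move=> rux; rewrite lt_neqAle ge_inf ?andbT//; last by exists x0.
  (* Were [x] the infimum, continuity would put [x - d / 2] in the set as well. *)
  apply/eqP => Ax; have /= := u_cont x.
  move=> /cvgr_gt/(_ _ rux)/nbhs_ballP[d /= d0 xd].
  have /ge_inf : A (x - d / 2).
    apply: xd; rewrite /ball/= opprD addrA subrr add0r opprK ger0_norm; lra.
  by move=> /(_ ltac:(by exists x0)); rewrite Ax; lra.
- move=> /inf_lt => /(_ A0)[y /= ruy yx]; apply: lt_le_trans ruy _.
  exact/u_homo/ltW.
Qed.

(** * Integrals of the weights under F and under its convolution square *)

Section exponential_weights.
Context {R : realType} (F : probability R R) (g : R).
Hypothesis g0 : 0 <= g.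

Lemma measurable_expRM (k : R) :
  measurable_fun setT (fun x : R => (expR (k * x))%:E).
Proof.
by apply/measurable_EFinP; exact: measurableT_comp.
Qed.

Lemma mgf_ge0 k : (0 <= mgf F k)%E.
Proof. by apply: integral_ge0 => x _; rewrite lee_fin expR_ge0. Qed.

Lemma integral_bump_conv_le (e T : R) : 1 <= T ->
  (\int[F \x F]_z (expbump g e T (z.1 + z.2))%:E <=
   \int[F]_x (expbump g e T x)%:E * \int[F]_x (expbump g e T x)%:E +
   \int[F]_x (expbump g e T x)%:E * mgf F g +
   mgf F g * \int[F]_x (expbump g e T x)%:E)%E.
Proof.
move=> T1; set M := (\int[F]_x (expbump g e T x)%:E)%E.
have mb : measurable_fun setT (fun x : R => (expbump g e T x)%:E).
  by apply/measurable_EFinP; exact: measurable_bump.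
have me := measurable_expRM g.
have b0 x : (0 <= (expbump g e T x)%:E)%E by rewrite lee_fin bump_ge0.
have e0 x : (0 <= (expR (g * x))%:E)%E by rewrite lee_fin expR_ge0.
have M0 : (0 <= M)%E by exact: integral_ge0.
have f0 := mgf_ge0 g.
have mbD : measurable_fun setT (fun z : R * R => (expbump g e T (z.1 + z.2))%:E).
  apply/measurable_EFinP; apply: measurableT_comp; first exact: measurable_bump.
  exact: measurable_funD.
rewrite fubini_tonelli1//.
(* The right-hand side is unfolded into an iterated integral, first in [x] and then in [y], until
   [bumpD] compares the integrands pointwise. *)
have -> : (M * M + M * mgf F g + mgf F g * M = \int[F]_x
   ((expbump g e T x)%:E * M + (expbump g e T x)%:E * mgf F g +
    (expR (g * x))%:E * M))%E.
  rewrite !ge0_integralD ?ge0_integralZr//; do ?[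
    by move=> x _; rewrite ?adde_ge0 ?mule_ge0//
  | by do ?apply: emeasurable_funD; apply: emeasurable_funM].
apply: ge0_le_integral => //.
- by move=> x _; apply: integral_ge0 => y _; exact: b0.
- exact: measurable_fun_fubini_tonelli_F.
- by do ?apply: emeasurable_funD; apply: emeasurable_funM.
move=> x _; rewrite /fubini_F/=.
have -> : ((expbump g e T x)%:E * M + (expbump g e T x)%:E * mgf F g +
    (expR (g * x))%:E * M = \int[F]_y
   ((expbump g e T x)%:E * (expbump g e T y)%:E +
    (expbump g e T x)%:E * (expR (g * y))%:E +
    (expR (g * x))%:E * (expbump g e T y)%:E))%E.
  rewrite !ge0_integralD ?ge0_integralZl//; do ?[
    by move=> y _; rewrite ?adde_ge0 ?mule_ge0//
  | by do ?apply: emeasurable_funD; apply: emeasurable_funM].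
apply: ge0_le_integral => //.
- apply/measurable_EFinP; apply: measurableT_comp; first exact: measurable_bump.
  exact: measurable_funD.
- by do ?apply: emeasurable_funD; apply: emeasurable_funM.
- by move=> y _; rewrite -!EFinM -!EFinD lee_fin bumpD.
Qed.

(** Layer-cake comparison with cut-off level u(x0): above that level the event u > r is empty or a
    half-line starting beyond [x0], where the tail inequality is available. *)
Lemma integral_bump_tail_le (e T k x0 : R) : 0 <= e -> 0 <= k ->
  (forall x, x0 <= x -> (k%:E * F [set y | (x < y)%R] <=
     (F \x F) [set z | (x < z.1 + z.2)%R])%E) ->
  (k%:E * \int[F]_x (expbump g e T x)%:E <=
   \int[F \x F]_z (expbump g e T (z.1 + z.2))%:E + (k * expbump g e T x0)%:E)%E.
Proof.
move=> e0 k0 Fk.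
apply: (@ge0_integral_tail_le _ _ _ _ _ (F \x F)%E F
  (fun z : R * R => expbump g e T (z.1 + z.2)) (expbump g e T)) => //.
- apply: measurableT_comp; first exact: measurable_bump.
  exact: measurable_funD.
- exact: measurable_bump.
- by move=> x; exact: bump_ge0.
- by move=> x; exact: bump_ge0.
- exact: bump_ge0.
move=> r ur; have [] := superlevel_homo_continuous _ _ _
  (bump_homo g e g0 e0 T) (bump_continuous g e T) ur.
  by move=> ->; rewrite measure0 mule0.
move=> [a x0a uE].
have -> : [set z : R * R | r < expbump g e T (z.1 + z.2)] =
    [set z | a < z.1 + z.2].
  by apply: funext => z; exact: (congr1 (fun A => A (z.1 + z.2)) uE).
by rewrite uE; exact: Fk.
Qed.

End exponential_weights.

(** * Upper bound for the limit of the convolution ratio *)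

Section upper_bound.
Context {R : realType} (F : probability R R) (g : R).
Hypothesis g0 : 0 <= g.
Hypothesis mgf_fin : (mgf F g < +oo)%E.

Let phi := fine (mgf F g).
Let phiE : mgf F g = phi%:E.
Proof. by rewrite fineK// ge0_fin_numE// mgf_ge0. Qed.
Let phi0 : 0 <= phi. Proof. by rewrite fine_ge0// mgf_ge0. Qed.

(** By monotone convergence in the truncation level, a common bound [A] would give phi(g + e) <= A +
    phi(g), which is finite. *)
Lemma integral_bump_unbounded (e h A : R) : 0 <= e -> 0 < h ->
  (mgf F (g + e) = +oo)%E ->
  exists k : nat, (A%:E < \int[F]_x (expbump g e (1 + k%:R * h) x)%:E)%E.
Proof.
move=> e0 h0 mgfoo; apply/not_existsP => bounded.
pose b (k : nat) x := (expbump g e (1 + k%:R * h) x)%:E.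
have mb k : measurable_fun setT (b k).
  by apply/measurable_EFinP; exact: measurable_bump.
have b0 k x : (0 <= b k x)%E by rewrite lee_fin bump_ge0.
have b_homo x : {homo b^~ x : k l / (k <= l)%N >-> (k <= l)%E}.
  move=> k l kl; rewrite lee_fin bump_homoT// lerD2l ler_wpM2r ?ler_nat//.
  exact: ltW.
have mL : measurable_fun setT (fun x : R => limn (b^~ x)).
  apply: (emeasurable_fun_cvg b) => // x _.
  exact: ereal_nondecreasing_is_cvgn.
have L0 x : (0 <= limn (b^~ x))%E.
  apply: lime_ge; first exact: ereal_nondecreasing_is_cvgn.
  exact: nearW.
have : (\int[F]_x limn (b^~ x) <= A%:E)%E.
  rewrite monotone_convergence//.
  apply: lime_le.
    apply: ereal_nondecreasing_is_cvgn => k l kl.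
    by apply: ge0_le_integral => // x _; exact: b_homo.
  by apply: nearW => k; rewrite leNgt; apply/negP; exact: bounded.
move=> LA; suff : (mgf F (g + e) <= A%:E + mgf F g)%E.
  by rewrite mgfoo phiE -EFinD leye_eq.
apply: (@le_trans _ _ (\int[F]_x (limn (b^~ x) + (expR (g * x))%:E))%E).
  apply: ge0_le_integral => //.
  - exact: measurable_expRM.
  - by apply: emeasurable_funD => //; exact: measurable_expRM.
  move=> x _; rewrite -leeBlDr//; apply: lime_ge.
    exact: ereal_nondecreasing_is_cvgn.
  (* For fixed [x] the truncation is inactive as soon as 1 + k h >= e^(e x). *)
  near=> k; rewrite leeBlDr// -EFinD lee_fin expRD_le_bump//.
  rewrite -lerBlDl -ler_pdivrMr//; near: k; exact: nbhs_infty_ger.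
rewrite ge0_integralD//; last exact: measurable_expRM.
by rewrite leeD.
Unshelve. all: by end_near. Qed.

(* Each step of length [h] in [T] raises the integral by at most [s / 2], so
   the first value above [s / 2] is still at most [s]. *)
Lemma exists_integral_bump (e s : R) : 0 <= e -> 0 < s ->
  (mgf F (g + e) = +oo)%E ->
  exists T M, [/\ 1 <= T, (\int[F]_x (expbump g e T x)%:E)%E = M%:E,
    s / 2 < M & M <= s].
Proof.
move=> e0 s0 mgfoo.
pose h := s / 2 / (phi + 1).
have h0 : 0 < h by rewrite !divr_gt0// ltr_wpDl.
pose I k := (\int[F]_x (expbump g e (1 + k%:R * h) x)%:E)%E.
have I0 : I 0%N = 0%E.
  by apply: integral0_eq => x _; rewrite mul0r addr0 bump1.
have IS k : (I k.+1 <= I k + (s / 2)%:E)%E.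
  have mb T : measurable_fun setT (fun x => (expbump g e T x)%:E).
    by apply/measurable_EFinP; exact: measurable_bump.
  have b0 T x : (0 <= (expbump g e T x)%:E)%E by rewrite lee_fin bump_ge0.
  have me := measurable_expRM g; have := ltW h0 => h0'.
  apply: (@le_trans _ _ (I k + h%:E * mgf F g)%E).
    rewrite /mgf -ge0_integralZl_EFin//.
    rewrite -ge0_integralD//; last 2 first.
    - by move=> x _; rewrite lee_fin mulr_ge0 ?expR_ge0// ltW.
    - exact: measurable_funeM.
    apply: ge0_le_integral => //.
    - by apply: emeasurable_funD => //; exact: measurable_funeM.
    - move=> x _; rewrite -EFinM -EFinD lee_fin.
      rewrite -natr1 mulrDl mul1r addrA.
      by apply: bump_lipschitz; exact: ltW.
  rewrite leeD2l// phiE -EFinM lee_fin /h mulrAC.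
  by rewrite ler_pdivrMr ?ltr_wpDl// ler_pM2l ?divr_gt0// lerDl.
have exI : exists k, ((s / 2)%:E < I k)%E by exact: integral_bump_unbounded.
(* At [k = 0] the level is [T = 1] and the weight vanishes, so the least index is a successor and
   its predecessor is still at most s / 2. *)
have [[|k] Ik mink] := ex_minnP exI.
  by move: Ik; rewrite I0 lte_fin; lra.
have Iks : (I k.+1 <= s%:E)%E.
  apply: le_trans (IS k) _; rewrite [in leRHS](splitr s) EFinD leeD2r//.
  by rewrite leNgt; apply/negP => /mink; rewrite ltnn.
have Ifin : I k.+1 \is a fin_num.
  by rewrite fin_real// (lt_trans _ Ik) ?ltNye// (le_lt_trans Iks) ?ltry.
exists (1 + k.+1%:R * h), (fine (I k.+1)); split => //.
- by rewrite lerDl mulr_ge0// ltW.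
- by rewrite -/(I k.+1) fineK.
- by rewrite -lte_fin fineK.
- by rewrite -lee_fin fineK.
Qed.

Lemma conv_tail_ratio_le (k x0 : R) : 0 <= k -> 0 < x0 ->
  (forall e, 0 < e -> mgf F (g + e) = +oo%E) ->
  (forall x, x0 <= x -> (k%:E * F [set y | (x < y)%R] <=
     (F \x F) [set z | (x < z.1 + z.2)%R])%E) ->
  k <= 2 * phi.
Proof.
move=> k0 x00 mgfoo Fk; rewrite leNgt; apply/negP => kphi.
pose d := k - 2 * phi; have d0 : 0 < d by rewrite /d; lra.
have kpos : 0 < k by have := phi0; lra.
pose K := k * expR (g * x0); have K0 : 0 < K by rewrite mulr_gt0// expR_gt0.
(* With e^(e x0) = 1 + eta, [bump_le] gives k u(x0) <= K eta = d^2 / 8 for every [T]. *)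
pose eta := d ^+ 2 / 8 / K; have eta0 : 0 < eta by rewrite !divr_gt0 ?exprn_gt0.
pose e := ln (1 + eta) / x0.
have e0 : 0 < e by rewrite divr_gt0// ln_gt0// ltrDl.
have [||T [M [T1 ME sM Ms]]] := @exists_integral_bump e (d / 2) (ltW e0).
- by rewrite divr_gt0.
- exact: mgfoo.
have := le_trans (integral_bump_tail_le F g g0 e T k x0 (ltW e0) k0 Fk)
  (leeD2r _ (integral_bump_conv_le F g e T T1)).
rewrite ME phiE -!EFinM -!EFinD lee_fin.
have : k * expbump g e T x0 <= d ^+ 2 / 8.
  have := bump_le g e (ltW e0) T _ (ltW x00).
  rewrite /e divfK ?gt_eqF// lnK ?posrE ?addr_gt0// addrAC subrr add0r.
  move=> /(ler_wpM2l k0)/le_trans; apply.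
  by rewrite mulrA -/K /eta mulrC divfK// gt_eqF.
(* The inequalities combine to M (d - M) <= d^2 / 8. But d / 4 < M <= d / 2 makes the left side
   exceed (d / 4) (d / 2), a contradiction. *)
have : k = d + 2 * phi by rewrite /d subrK.
nra.
Qed.

End upper_bound.

(** * Lower limits and neighbourhoods of infinity *)

Lemma limn_einf_le_near {R : realType} (u : (\bar R)^nat) (b : \bar R) :
  (\forall n \near \oo, u n <= b)%E -> (limn_einf u <= b)%E.
Proof.
move=> [N _ uNb]; rewrite limn_einf_lim.
apply: lime_le; first exact: is_cvg_einfs.
apply: nearW => n; apply: (le_trans _ (uNb (maxn n N) (leq_maxr _ _))).
by apply: ereal_inf_lbound; exists (maxn n N) => //=; exact: leq_maxl.
Qed.

Lemma limf_einf_gt_near {R : realType} (f : R -> \bar R)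
  (G : set_system R) (a : \bar R) : Filter G ->
  (a < limf_einf f G)%E -> \forall x \near G, (a < f x)%E.
Proof.
move=> FG; rewrite limf_einfE => /ereal_sup_gt[_ [V GV <-] aV].
apply: filterS GV => x Vx; apply: lt_le_trans aV _.
by apply: ereal_inf_lbound; exists x.
Qed.

Lemma cvg_le_limf_einf {R : realType} (f : R -> R)
  (G : set_system R) (l : R) : Filter G ->
  f x @[x --> G] --> l -> (l%:E <= limf_einf (fun x => (f x)%:E) G)%E.
Proof.
move=> FG fl; apply/lee_addgt0Pr => e e0; rewrite -leeBlDr// limf_einfE -EFinB.
apply: le_ereal_sup_tmp; exists (ereal_inf
  ((fun x => (f x)%:E) @` [set x | l - e <= f x])).
  exists [set x | l - e <= f x] => //.
  by apply: (cvgr_ge l fl); lra.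
by apply: le_ereal_inf_tmp => _ [x /= lx <-]; rewrite lee_fin.
Qed.

Lemma near_pinfty_shift {R : numFieldType} (P : R -> Prop) (y : R) :
  y \is Num.real ->
  (\forall x \near +oo, P x) -> \forall x \near +oo, P (x + y).
Proof.
move=> yR [M [MR MP]]; exists (M - y); split; first exact: realB.
by move=> x; rewrite ltrBlDr => /MP.
Qed.

(** * Tails of the convolution and the Fatou lower bound *)

Section tails.
Context {R : realType} (F : probability R R).

Lemma tailE (x : R) : (tail F x)%:E = F [set y | x < y].
Proof.
rewrite /tail fineK// fin_num_measure// -set_itvoy; exact: measurable_itv.
Qed.

Lemma tail_gt0 (x : R) : unbounded_support F -> 0 < tail F x.
Proof. by move=> /(_ x); rewrite -tailE lte_fin. Qed.

Lemma measurable_sum_gt (x : R) :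
  measurable [set z : R * R | x < z.1 + z.2].
Proof.
have := @measurable_fun_ltr _ (R * R)%type R setT (fun=> x)
  (fun z => z.1 + z.2).
move=> /(_ (measurable_cst _))/(_ ltac:(exact: measurable_funD)).
by move=> /(_ measurableT [set true] I); rewrite setTI.
Qed.

Lemma conv_tailE (x : R) : (conv_tail F x)%:E = (F \x F)%E [set z | x < z.1 + z.2].
Proof.
rewrite /conv_tail fineK//.
rewrite ge0_fin_numE//; apply: le_lt_trans (ltry 1).
exact: (@probability_le1 _ _ _ (F \x F)%E _ (measurable_sum_gt x)).
Qed.

(** Cutting at x / 2 makes this event disjoint from its mirror image, while for fixed y its section
    is the whole half-line beyond x - y once x >= 2 y. *)
Let below (x : R) : set (R * R) := [set z | z.1 <= x / 2 /\ x < z.1 + z.2].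

Let measurable_below (x : R) : measurable (below x).
Proof.
rewrite (_ : below x =
    (`]-oo, x / 2] `*` setT) `&` [set z | x < z.1 + z.2]); last first.
  apply/seteqP; split => [z [zx xz]|z [[/= + _] xz]]; last by rewrite in_itv.
  by split => //; split => //=; rewrite in_itv.
by apply: measurableI; [exact: measurableX|exact: measurable_sum_gt].
Qed.

Let below_section (x y : R) : y <= x / 2 ->
  F (xsection (below x) y) = (tail F (x - y))%:E.
Proof.
move=> yx; rewrite tailE; congr (F _); apply/seteqP; split => t /=.
  by rewrite /xsection/= inE /below/= => -[_]; lra.
by rewrite /xsection/= inE /below/= => xyt; split => //; lra.
Qed.

Lemma conv_tail_ge (x : R) : (2%:E * \int[F]_y F (xsection (below x) y) <=
  (conv_tail F x)%:E)%E.
Proof.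
pose above : set (R * R) := [set z | below x (z.2, z.1)].
have mabove : measurable above.
  have := @measurable_swap _ _ R R measurableT _ (measurable_below x).
  by rewrite setTI.
(* Tonelli in the other order: fixing the second coordinate in [above] gives the sections of
   [below], so the two events are equally likely. *)
have swapE : (\int[F]_y F (xsection (below x) y) = (F \x F)%E above)%E.
  rewrite -[above]setIT -(@integral_indic _ _ _ (F \x F)%E)//.
  rewrite fubini_tonelli2//; last exact/measurable_EFinP/measurable_indic.
  apply: eq_integral => y _; rewrite /fubini_G /=.
  rewrite (eq_integral (fun t => (\1_(xsection (below x) y) t)%:E));
    last first.
    by move=> t _; rewrite !indicE /xsection/= mem_setE.
  by rewrite integral_indic ?setIT//; exact: measurable_xsection.
rewrite conv_tailE mule_natl mule2n {2}swapE.
rewrite -[X in (X + _)%E]/((F \x F)%E (below x)) -measureU//; last first.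
  by apply/seteqP; split => // -[a b] [[/= ax xab] [/= bx _]]; clear swapE; lra.
rewrite le_measure ?inE//=; [exact: measurableU|exact: measurable_sum_gt|].
by move=> [a b] [] [/= _ ?] //=; rewrite addrC.
Qed.

(** Fatou along the integers: [f n y] equals the tail ratio once n >= 2 y, hence tends to e^(g y),
    and by [conv_tail_ge] twice its integral is at most the convolution ratio. The left side is an
    extended real, so the bound also shows that phi(g) is finite. *)
Lemma mgf_le_conv_ratio (g c : R) : unbounded_support F ->
  (forall y, tail F (x - y) / tail F x @[x --> +oo] --> expR (g * y)) ->
  conv_tail F x / tail F x @[x --> +oo] --> c ->
  (2%:E * mgf F g <= c%:E)%E.
Proof.
move=> F0 Fg Fc.
pose f (n : nat) y := (F (xsection (below n%:R) y) * ((tail F n%:R)^-1)%:E)%E.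
have mb (n : nat) : measurable_fun setT (fun y => F (xsection (below n%:R) y)).
  exact: measurable_fun_xsection.
have mf n : measurable_fun setT (f n) by apply: emeasurable_funM.
have f0 n y : (0 <= f n y)%E.
  by rewrite mule_ge0// lee_fin invr_ge0 ltW// tail_gt0.
have natoo : (n%:R : R) @[n --> \oo] --> +oo by exact: cvgr_idn.
have limf y : limn_einf (f^~ y) = (expR (g * y))%:E.
  apply: (cvg_limn_einf_sup _).1.
  apply: (@cvg_trans _ ((tail F (n%:R - y) / tail F n%:R)%:E @[n --> \oo])).
    apply: near_eq_cvg; near=> n; rewrite /f below_section ?EFinM//.
    rewrite ler_pdivlMr//; near: n; exact: nbhs_infty_ger.
  apply: cvg_EFin; first exact: nearW.
  exact: ((cvg_pinftyP _ _).1 (Fg y)).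
apply/lee_addgt0Pr => e e0.
rewrite -lee_pdivlMl// -EFinD -EFinM.
apply: le_trans (limn_einf_le_near (fun n => \int[F]_y f n y)%E _ _).
  rewrite /mgf; under eq_integral do rewrite -limf.
  exact: fatou.
have : \forall n \near \oo, conv_tail F n%:R / tail F n%:R <= c + e.
  by apply: (cvgr_le c ((cvg_pinftyP _ _).1 Fc _ natoo)); lra.
apply: filterS => n; rewrite ler_pdivrMr ?tail_gt0// => nce.
rewrite /f ge0_integralZr//; last by rewrite lee_fin invr_ge0 ltW// tail_gt0.
rewrite lee_pdivrMr ?tail_gt0// -EFinM -mulrA EFinM lee_pdivlMl//.
by apply: le_trans (conv_tail_ge _) _; rewrite lee_fin.
Unshelve. all: by end_near. Qed.

End tails.

(** * Exponential tail ratios and the abscissa of convergence *)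

Section long_tails.
Context {R : realType} (F : probability R R) (g : R).
Hypothesis F0 : unbounded_support F.

(** The lower limit at [- y] bounds the ratio from below; the one at [y], moved to the point x + y,
    bounds its reciprocal from below. *)
Lemma liminf_tail_ratio_cvg :
  (forall y : R, ((expR (g * y))%:E <=
    limf_einf (fun x => (tail F (x - y) / tail F x)%:E) (pinfty_nbhs R))%E) ->
  forall y : R, tail F (x + y) / tail F x @[x --> +oo] --> expR (- g * y).
Proof.
move=> Fliminf y.
have lower z d : d < expR (g * z) ->
    \forall x \near +oo, d < tail F (x - z) / tail F x.
  move=> dz.
  have := @limf_einf_gt_near R _ _ d%:E _ (lt_le_trans _ (Fliminf z)).
  by rewrite lte_fin => /(_ _ dz); apply: filterS => x; rewrite lte_fin.
have gy : expR (g * y) = (expR (- g * y))^-1 by rewrite mulNr expRN invrK.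
have ey := expR_gt0 (- g * y).
apply/cvgrPdist_lt => e e0.
have up : \forall x \near +oo,
    (expR (- g * y) + e)^-1 < tail F x / tail F (x + y).
  have : \forall x \near +oo,
      (expR (- g * y) + e)^-1 < tail F (x - y) / tail F x.
    by apply: lower; rewrite gy ltf_pV2 ?posrE ?addr_gt0// ltrDl.
  move=> /(near_pinfty_shift _ _ (num_real y)).
  by apply: filterS => x; rewrite addrK.
have low : \forall x \near +oo,
    expR (- g * y) - e < tail F (x - - y) / tail F x.
  by apply: lower; rewrite mulrN -mulNr ltrBlDr ltrDl.
near=> x.
have xlow : expR (- g * y) - e < tail F (x - - y) / tail F x by near: x.
have : (expR (- g * y) + e)^-1 < tail F x / tail F (x + y) by near: x.
rewrite opprK in xlow.
rewrite -[ltRHS]invf_div ltf_pV2 ?posrE ?divr_gt0 ?addr_gt0 ?tail_gt0//.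
by move=> xup; rewrite distrC ltr_distl xlow xup.
Unshelve. all: by end_near. Qed.

(** For q strictly between g and h, the tail eventually loses at most a factor e^(-q) per unit step,
    whereas by Markov's inequality a finite phi(h) would force decay at rate h. *)
Lemma mgf_infty (h : R) : 0 <= g -> g < h ->
  tail F (x + 1) / tail F x @[x --> +oo] --> expR (- g) -> mgf F h = +oo%E.
Proof.
move=> g0 gh Fg; apply/eqP; rewrite -leye_eq leNgt; apply/negP => mgf_fin.
have h0 : 0 < h by lra.
pose m := fine (mgf F h).
have markov x : tail F x * expR (h * x) <= m.
  rewrite -lee_fin /m fineK ?ge0_fin_numE ?mgf_ge0// EFinM tailE.
  have mx : measurable [set y : R | x < y].
    by rewrite -set_itvoy; exact: measurable_itv.
  rewrite muleC -integral_cst//.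
  apply: (@le_trans _ _ (\int[F]_(y in [set y | (x < y)%R]) (expR (h * y))%:E)%E).
    apply: ge0_le_integral => //.
    - by move=> y _; rewrite lee_fin expR_ge0.
    - by apply: measurable_funTS; exact: measurable_expRM.
    - by move=> y /= xy; rewrite lee_fin ler_expR ler_pM2l// ltW.
  apply: ge0_subset_integral => //; exact: measurable_expRM.
pose q := (g + h) / 2.
have [N [_ decay]] : \forall x \near +oo,
    expR (- q) < tail F (x + 1) / tail F x.
  by apply: (cvgr_gt _ Fg); rewrite ltr_expR /q; lra.
(* The base point is [N + 1] because [decay] holds only strictly beyond [N]. *)
have decay_n n : tail F (N + 1) * expR (- q * n%:R) <= tail F (N + 1 + n%:R).
  elim: n => [|n IH]; first by rewrite mulr0 expR0 mulr1 addr0.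
  rewrite -natr1 mulrDr mulr1 expRD mulrA [N + 1 + _]addrA.
  have /decay : N < N + 1 + n%:R by rewrite -addrA ltrDl ltr_pwDl.
  rewrite ltr_pdivlMr ?tail_gt0// => /ltW; apply: le_trans.
  by rewrite mulrC ler_pM2l ?expR_gt0.
pose a := tail F (N + 1) * expR (h * (N + 1)).
have a0 : 0 < a by rewrite mulr_gt0 ?tail_gt0 ?expR_gt0.
(* The linear minorant of the exponential already outgrows [m], with an explicit [n]. *)
have growth n : a * (1 + (h - q) * n%:R) <= m.
  apply: le_trans (markov (N + 1 + n%:R)).
  apply: (@le_trans _ _ (a * expR ((h - q) * n%:R))).
    by rewrite ler_pM2l// expR_ge1Dx.
  have -> : a * expR ((h - q) * n%:R) =
      tail F (N + 1) * expR (- q * n%:R) * expR (h * (N + 1 + n%:R)).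
    by rewrite /a -!mulrA -!expRD; congr (_ * expR _); ring.
  by rewrite ler_pM2r ?expR_gt0.
have hq : 0 < h - q by rewrite /q; lra.
pose n := Num.truncn (m / a / (h - q)).
have := growth n.+1.
rewrite leNgt => /negP; apply.
rewrite -ltr_pdivrMl// ltr_wpDl// -ltr_pdivrMl//.
by rewrite [ltLHS]mulrC [a^-1 * m]mulrC truncnS_gt.
Qed.

(** Supplies c >= 2 in (b): the weight is at least 1 on the half-line that carries all the mass. *)
Lemma mgf_ge1 : supported_on_nonneg F -> 0 <= g -> (1 <= mgf F g)%E.
Proof.
move=> Fpos g0.
have mpos : measurable [set x : R | 0 <= x].
  by rewrite -set_itvcy; exact: measurable_itv.
have <- : F [set x | 0 <= x] = 1%E.
  have -> : [set x : R | 0 <= x] = ~` [set x | x < 0].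
    by apply/seteqP; split => x /=; rewrite leNgt => /negP.
  rewrite probability_setC ?Fpos ?sube0//.
  by rewrite -set_itvNyo; exact: measurable_itv.
rewrite -[leLHS]mul1e -integral_cst//.
apply: (@le_trans _ _ (\int[F]_(x in [set x | (0 <= x)%R]) (expR (g * x))%:E)%E).
  apply: ge0_le_integral => //.
  - by apply: measurable_funTS; exact: measurable_expRM.
  - by move=> x /= x0; rewrite lee_fin -expR0 ler_expR mulr_ge0.
apply: ge0_subset_integral => //; exact: measurable_expRM.
Qed.

End long_tails.

Theorem theorem7 (R : realType) (F : probability R R) (g : R) :
  supported_on_nonneg F -> unbounded_support F -> 0 <= g ->
  (class_S g F <->
   [/\ g%:E = gamma_hat F,
       (exists c : R, 2 <= c /\ conv_tail F x / tail F x @[x --> +oo] --> c) &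
       (forall y : R,
          ((expR (g * y))%:E <=
           limf_einf (fun x => (tail F (x - y) / tail F x)%:E) (pinfty_nbhs R))%E)]).
Proof.
move=> Fpos F0 g0; split => [[mgf_fin Fg Fc]|[gE [c [_ Fc]] Fliminf]].
- have mgf_num : mgf F g \is a fin_num by rewrite ge0_fin_numE// mgf_ge0.
  split.
  (* Finiteness of phi(g) puts g below the supremum; [mgf_infty] excludes every h > g from the
     set. *)
  + apply/eqP; rewrite eq_le; apply/andP; split.
      by apply: ereal_sup_ubound; exists g.
    apply: ge_ereal_sup => _ [h /= mgfh <-].
    rewrite lee_fin leNgt; apply/negP => gh; move: mgfh.
    have := Fg 1; rewrite mulr1 => /(mgf_infty F g F0 h g0 gh) ->.
    by rewrite ltxx.
  + exists (2 * fine (mgf F g)); split => //.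
    by rewrite ler_pMr// -lee_fin fineK// mgf_ge1.
  + move=> y; apply: cvg_le_limf_einf.
    by have := Fg (- y); rewrite mulrNN.
- have Fg := liminf_tail_ratio_cvg F g F0 Fliminf.
  have mgfc : (2%:E * mgf F g <= c%:E)%E.
    apply: (mgf_le_conv_ratio F g c F0 _ Fc) => y.
    by have := Fg (- y); rewrite mulrNN.
  have mgf_fin : (mgf F g < +oo)%E.
    move: mgfc; rewrite muleC -lee_pdivlMr// => /le_lt_trans; apply.
    by rewrite -EFinM ltry.
  have mgf_num : mgf F g \is a fin_num by rewrite ge0_fin_numE// mgf_ge0.
  split => //; suff <- : c = 2 * fine (mgf F g) by [].
  (* The bound 2 phi(g) <= c is already [mgfc]; the converse applies [conv_tail_ratio_le] with k = c
     - e for each e > 0. *)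
  apply/eqP; rewrite eq_le; apply/andP; split; last first.
    by rewrite -lee_fin EFinM fineK.
  apply/ler_addgt0Pr => e e0; rewrite -lerBlDr.
  have mgfoo e' : 0 < e' -> mgf F (g + e') = +oo%E.
    move=> e'0; apply/eqP; rewrite -leye_eq leNgt; apply/negP => mgfe'.
    have : ((g + e')%:E <= gamma_hat F)%E.
      by apply: ereal_sup_ubound; exists (g + e').
    by rewrite -gE lee_fin gerDl leNgt e'0.
  (* [conv_tail_ratio_le] wants k >= 0; for c - e <= 0 the bound is immediate. *)
  have [ce0|/ltW ce0] := leP (c - e) 0.
    by rewrite (le_trans ce0)// mulr_ge0// fine_ge0// mgf_ge0.
  have [N [_ Nc]] : \forall x \near +oo, c - e < conv_tail F x / tail F x.
    by apply: (cvgr_gt _ Fc); rewrite ltrBlDr ltrDl.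
  (* This threshold is positive and strictly beyond [N], as [Nc] requires. *)
  apply: (@conv_tail_ratio_le _ F g g0 mgf_fin _ (Num.max N 0 + 1)) => //.
    by rewrite ltr_wpDl// le_max lexx orbT.
  move=> x Nx; rewrite -tailE -conv_tailE -EFinM lee_fin.
  rewrite -ler_pdivlMr ?tail_gt0// ltW// Nc//.
  by apply: lt_le_trans Nx; rewrite ltr_pwDr// le_max lexx.
Qed.
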